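(* For every numeration base $b\ge 2$ there exist an infinite set of $b$-ARH numbers and an infinite set of additive multipliers (of $b$-ARH numbers). Moreover, the $b$-ARH numbers in the infinite set are also $b$-Niven numbers.
   Context: Let $b\ge 2$ be a numeration base. $s_b(N)$ is the sum of the base $b$ digits of $N$. The reversal $N^R$ of a nonnegative integer $N$ is the integer obtained by writing the base $b$ digits of $N$ (without leading zeros) in reverse order, i.e. if $N=\sum_{i=0}^{d-1} n_i b^i$ with $0\le n_i<b$, $n_{d-1}\neq 0$, then $N^R=\sum_{i=0}^{d-1} n_i b^{d-1-i}$ (and $0^R=0$). A positive integer $N$ is a $b$-ARH ($b$-additive Ramanujan-Hardy) number if there is a nonnegative integer $M$ such that $N=s_b(N)M+(s_b(N)M)^R$; any such $M$ is called an additive multiplier (for $N$). A positive integer $N$ is a $b$-Niven number if $s_b(N)$ divides $N$. *)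

(* Defs.v *)
From mathcomp Require Import all_boot.
From mathcomp Require Import classical_sets cardinality.

Set Implicit Arguments.
Unset Strict Implicit.
Unset Printing Implicit Defensive.

(* For 1 < b this is the least e such that N < b ^ e, hence the length of the
   base b expansion of N without leading zeros; it is 0 for N = 0. *)
Definition num_digits (b N : nat) : nat := up_log b N.+1.

(* The coefficient of b ^ i in the base b expansion of N. *)
Definition digit (b N i : nat) : nat := (N %/ b ^ i) %% b.

Definition digit_sum (b N : nat) : nat :=
  \sum_(i < num_digits b N) digit b N i.

Definition reversal (b N : nat) : nat :=
  \sum_(i < num_digits b N) digit b N i * b ^ (num_digits b N - 1 - i).

Definition additive_multiplier (b N M : nat) : Prop :=
  N = digit_sum b N * M + reversal b (digit_sum b N * M).

Definition ARH (b N : nat) : Prop :=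
  0 < N /\ exists M : nat, additive_multiplier b N M.

Definition Niven (b N : nat) : Prop :=
  0 < N /\ digit_sum b N %| N.

(* Main.v *)
Require Import Defs.
From mathcomp Require Import all_boot.
From mathcomp Require Import classical_sets cardinality.

(** The construction rests on palindromes: if [P = P^R] and [s], the digit sum
    of [2 * P], divides [P], then [N = 2 * P = P + P^R] is both ARH, with
    multiplier [P %/ s], and Niven.

    Take for [P] the number with [b + 1] digits equal to [b - 1], at the
    positions [0, n, 2n, ..., bn], and all its other digits zero, where [n] is
    even and positive.  The positions are symmetric, so [P] is a palindrome
    ([reversal_spaced]).  Since [2(b - 1) = b + (b - 2)], doubling turns each
    nonzero digit into the pair of digits [1, b - 2], and the pairs do not
    overlap as [n >= 2]; hence [2 * P] has digit sum [(b + 1)(b - 1) = b^2 - 1]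
    ([digit_sum_double_spaced]).  Finally [P] is
    [b - 1] times a sum of [b + 1] powers [b^(nj)], each congruent to 1 modulo
    [b + 1] because [n] is even, so [b^2 - 1] divides [P]
    ([dvdn_digit_sum_spaced]).  Distinct values of [n] give
    distinct [P], because [P] has [bn + 1] digits, and hence distinct [N] and
    distinct multipliers, [s] being the same for all [n]. *)

(** * Base b expansions *)

Lemma num_digits_eq (b k N : nat) :
  1 < b -> b ^ k <= N < b ^ k.+1 -> num_digits b N = k.+1.
Proof. by move=> b_gt1 leNlt; apply: up_log_eq. Qed.

Lemma num_digits_le (b k N : nat) :
  1 < b -> N < b ^ k -> num_digits b N <= k.
Proof. by move=> b_gt1; apply: up_log_min. Qed.

Lemma digit_eq0 (b k N i : nat) : 0 < b -> N < b ^ k -> k <= i -> digit b N i = 0.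
Proof.
move=> b_gt0 ltN leki; rewrite /digit divn_small ?mod0n //.
by apply: leq_trans ltN _; rewrite leq_pexp2l.
Qed.

Lemma digit_sum_wide (b k N : nat) :
  1 < b -> N < b ^ k -> digit_sum b N = \sum_(i < k) digit b N i.
Proof.
move=> b_gt1 ltN; rewrite /digit_sum.
rewrite (big_ord_widen _ (digit b N) (num_digits_le _ _ _ b_gt1 ltN)).
rewrite [RHS](bigID (fun i : 'I_k => i < num_digits b N)) /=.
rewrite [X in _ + X]big1 ?addn0 // => i; rewrite -leqNgt.
by apply: digit_eq0; [apply: ltnW | apply: up_logP].
Qed.

Lemma sum_digits (b k N : nat) :
  N < b ^ k -> \sum_(i < k) digit b N i * b ^ i = N.
Proof.
elim: k N => [|k IHk] N ltN.
  by rewrite big_ord0; case: N ltN.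
rewrite big_ord_recl /digit expn0 divn1 muln1 addnC [RHS](divn_eq N b).
congr (_ + _); rewrite -[in RHS](IHk (N %/ b)); last first.
  by rewrite ltn_divLR -?expnSr // lt0n; apply: contraTneq ltN => ->; rewrite exp0n.
rewrite big_distrl; apply: eq_bigr => i _.
by rewrite /= /digit /bump /= add1n -divnMA -expnS expnSr mulnA.
Qed.

(** The low part [x] and the high part [y] share no position, so no carry takes
    place between them. *)
Lemma digit_cat (b k x y i : nat) :
  0 < b -> x < b ^ k ->
  digit b (x + b ^ k * y) i = if i < k then digit b x i else digit b y (i - k).
Proof.
move=> b_gt0 ltx; rewrite /digit; case: ltnP => [ltik | leki].
  rewrite -[in b ^ k](subnKC ltik) addSn -addnS expnD -mulnA.
  rewrite [b ^ i * _]mulnC divnDMl ?expn_gt0 ?b_gt0 //.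
  by rewrite expnS -mulnA addnC [b * _]mulnC modnMDl.
rewrite -[in LHS](subnKC leki) expnD divnMA [b ^ k * y]mulnC.
by rewrite divnDMl ?expn_gt0 ?b_gt0 // (divn_small ltx).
Qed.

Lemma ltn_cat (b k l x y : nat) :
  x < b ^ k -> y < b ^ l -> x + b ^ k * y < b ^ (k + l).
Proof.
move=> ltx lty; apply: (@leq_trans (b ^ k * y.+1)).
  by rewrite mulnS ltn_add2r.
by rewrite expnD leq_mul2l lty orbT.
Qed.

Lemma digit_sum_cat (b k x y : nat) :
  1 < b -> x < b ^ k ->
  digit_sum b (x + b ^ k * y) = digit_sum b x + digit_sum b y.
Proof.
move=> b_gt1 ltx; have lty : y < b ^ num_digits b y by apply: up_logP.
have b_gt0 := ltnW b_gt1.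
rewrite (digit_sum_wide _ _ _ b_gt1 (ltn_cat _ _ _ _ _ ltx lty)) big_split_ord /=.
rewrite (digit_sum_wide _ _ _ b_gt1 ltx); congr (_ + _); apply: eq_bigr => i _.
  by rewrite digit_cat // ltn_ord.
by rewrite digit_cat // ltnNge leq_addr /= addKn.
Qed.

Lemma digit_sum_small (b x : nat) : 1 < b -> x < b -> digit_sum b x = x.
Proof.
move=> b_gt1 ltx; rewrite (digit_sum_wide b 1) // big_ord1 /digit.
by rewrite expn0 divn1 modn_small.
Qed.

Lemma reversal_palindrome (b N : nat) :
  1 < b ->
  (forall i, i < num_digits b N -> digit b N (num_digits b N - i.+1) = digit b N i) ->
  reversal b N = N.
Proof.
move=> b_gt1 palN; have ltN : N < b ^ num_digits b N by apply: up_logP.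
rewrite -[RHS](sum_digits _ _ _ ltN) /reversal (reindex_inj rev_ord_inj) /=.
apply: eq_bigr => i _; rewrite palN //; congr (_ * b ^ _).
by rewrite -subnDA add1n subnSK // subKn // ltnW.
Qed.

(** * Equally spaced maximal digits *)

Definition spaced (b n c : nat) : nat := \sum_(j < c) b.-1 * b ^ (n * j).

(** Splitting off the lowest block of [n] positions gives the digits by
    induction; splitting off the top digit instead ([spacedSr]) gives the
    length. *)
Lemma spacedSl (b n c : nat) : spaced b n c.+1 = b.-1 + b ^ n * spaced b n c.
Proof.
rewrite /spaced big_ord_recl muln0 expn0 muln1 big_distrr; congr (_ + _).
by apply: eq_bigr => j _; rewrite /= /bump /= add1n mulnS expnD mulnCA.
Qed.

Lemma spacedSr (b n c : nat) : spaced b n c.+1 = spaced b n c + b.-1 * b ^ (n * c).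
Proof. by rewrite /spaced big_ord_recr. Qed.

Lemma spaced_ltn (b n c : nat) : 0 < b -> 0 < n -> spaced b n c < b ^ (n * c).
Proof.
move=> b_gt0 n_gt0; elim: c => [|c IHc]; first by rewrite /spaced big_ord0 expn_gt0 b_gt0.
rewrite spacedSl mulnS; apply: ltn_cat => //.
by rewrite prednK // -[X in X <= _]expn1 leq_pexp2l.
Qed.

Lemma num_digits_spaced (b n c : nat) :
  1 < b -> 0 < n -> num_digits b (spaced b n c.+1) = (n * c).+1.
Proof.
move=> b_gt1 n_gt0; have b_gt0 := ltnW b_gt1; apply: num_digits_eq => //.
rewrite spacedSr; apply/andP; split.
  rewrite -[X in X <= _]mul1n (leq_trans _ (leq_addl _ _)) // leq_mul2r.
  by rewrite -ltnS prednK // b_gt1 orbT.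
by rewrite expnS -[X in _ < X * _](prednK b_gt0) mulSn ltn_add2r spaced_ltn.
Qed.

Lemma digit_spaced (b n c i : nat) :
  1 < b -> 0 < n ->
  digit b (spaced b n c) i = if (i < n * c) && (n %| i) then b.-1 else 0.
Proof.
move=> b_gt1 n_gt0; have b_gt0 := ltnW b_gt1.
elim: c i => [|c IHc] i; first by rewrite muln0 /spaced big_ord0 /digit div0n mod0n.
rewrite spacedSl digit_cat //; last first.
  by rewrite prednK // -[X in X <= _]expn1 leq_pexp2l.
case: ltnP => [ltin | lein].
  rewrite (leq_trans ltin) ?leq_pmulr //=; case: i ltin => [|i] ltin.
    by rewrite dvdn0 /digit expn0 divn1 modn_small ?prednK.
  by rewrite gtnNdvd // (digit_eq0 b 1) ?expn1 ?prednK.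
by rewrite IHc mulnS ltn_subLR // dvdn_subl.
Qed.

(** The positions of the nonzero digits are the multiples of [n] up to [n * c],
    a set stable under [i |-> n * c - i]. *)
Lemma reversal_spaced (b n c : nat) :
  1 < b -> 0 < n -> reversal b (spaced b n c.+1) = spaced b n c.+1.
Proof.
move=> b_gt1 n_gt0; apply: reversal_palindrome => // i.
rewrite num_digits_spaced // subSS ltnS => lei.
have lt_nc j : j <= n * c -> j < n * c.+1.
  by rewrite mulnS => /leq_ltn_trans-> //; rewrite -[X in X < _]add0n ltn_add2r.
by rewrite !digit_spaced // !lt_nc ?leq_subr // dvdn_subr ?dvdn_mulr.
Qed.

(** Each double digit is [2(b - 1) = (b - 2) + b * 1], whose digit sum is
    [b - 1] again; it fits in the [n >= 2] positions available. *)
Lemma digit_sum_double_spaced (b n c : nat) :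
  1 < b -> 1 < n -> digit_sum b (2 * spaced b n c) = c * b.-1.
Proof.
case: b => [|[|b]] // _ n_gt1.
elim: c => [|c IHc]; first by rewrite /spaced big_ord0 digit_sum_small.
have double_digit : 2 * b.+1 = b + b.+2 ^ 1 * 1.
  by rewrite expn1 muln1 mul2n -addnn addSnnS.
rewrite spacedSl mulnDr mulnCA /= digit_sum_cat // ?IHc ?[c.+1 * _]mulSn; last first.
  apply: (@leq_trans (b.+2 ^ 2)); last by rewrite leq_pexp2l.
  by rewrite expnS expn1 (@leq_trans (2 * b.+2)) ?ltn_pmul2l ?leq_pmul2r.
congr (_ + _).
by rewrite double_digit digit_sum_cat // !digit_sum_small ?addn1 // expn1 ltnW.
Qed.

(** An even power of [b] is 1 modulo [b + 1], so the sum of [b + 1] of them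
    vanishes modulo [b + 1]; this is what fixes the number of nonzero digits. *)
Lemma dvdn_digit_sum_spaced (b m : nat) :
  0 < b -> b.+1 * b.-1 %| spaced b (2 * m) b.+1.
Proof.
case: b => // b _; rewrite /spaced -big_distrr [_ * b.+1.-1]mulnC dvdn_mul //=.
have sqr1 : b.+1 ^ 2 = 1 %[mod b.+2].
  have -> : b.+1 ^ 2 = b * b.+2 + 1.
    by rewrite expnS expn1 mulSn [b * b.+2]mulnS addn1 addSn.
  by rewrite modnMDl.
rewrite /dvdn -modn_summ (eq_bigr (fun=> 1)) ?sum1_card ?card_ord ?modnn //.
by move=> j _; rewrite -mulnA expnM -modnXm sqr1 modnXm exp1n modn_small.
Qed.

(** * The infinite families *)

Lemma infinite_range_inj (f : nat -> nat) :
  injective f -> infinite_set (range f).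
Proof.
move=> f_inj fin_f; apply: infinite_nat.
by rewrite -(preimage_range f); apply: finite_preimage fin_f; apply: in2W.
Qed.

Theorem proposition1 (b : nat) (hb : 2 <= b) :
  exists A B : set nat,
    [/\ infinite_set A,
        infinite_set B,
        forall N : nat, A N -> ARH b N,
        forall M : nat, B M ->
          exists N : nat, ARH b N /\ additive_multiplier b N M
      & forall N : nat, A N -> Niven b N].
Proof.
have b_gt0 := ltnW hb.
pose s := b.+1 * b.-1.
(* The spacing [2 * m.+1] is even, and at least 2 so that doubling does not
   make digits collide. *)
pose P m := spaced b (2 * m.+1) b.+1.
have s_gt0 : 0 < s by rewrite muln_gt0 /= -subn1 subn_gt0.
have P_size m : num_digits b (P m) = (2 * m.+1 * b).+1.
  exact: num_digits_spaced.
have P_inj : injective P.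
  move=> m m' /(congr1 (num_digits b)); rewrite !P_size => /succn_inj/eqP.
  by rewrite eqn_pmul2r // eqn_pmul2l // => /eqP[].
have dvd_sP m : s %| P m by exact: dvdn_digit_sum_spaced.
have sum2P m : digit_sum b (2 * P m) = s.
  by rewrite digit_sum_double_spaced // mulnS.
have multP m : additive_multiplier b (2 * P m) (P m %/ s).
  rewrite /additive_multiplier sum2P [s * _]mulnC divnK // reversal_spaced //.
  by rewrite mul2n addnn.
have P_gt0 m : 0 < 2 * P m.
  rewrite muln_gt0 /= lt0n; apply/eqP => P0.
  by have := P_size m; rewrite P0 /num_digits up_log1.
have ARH_P m : ARH b (2 * P m) by split=> //; exists (P m %/ s).
exists (range (fun m => 2 * P m)), (range (fun m => P m %/ s)); split.
- apply: infinite_range_inj => m m' /eqP.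
  by rewrite eqn_pmul2l // => /eqP/P_inj.
- apply: infinite_range_inj => m m' eqM; apply: P_inj.
  by rewrite -(divnK (dvd_sP m)) eqM divnK.
- by move=> _ [m _ <-].
- by move=> _ [m _ <-]; exists (2 * P m).
- by move=> _ [m _ <-]; split; rewrite // sum2P dvdn_mull.
Qed.
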